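(* Let $S$ be a complete semiring, $(\mathbf{C},\otimes,I)$ a small strict monoidal category, $\mathcal{F}$ a system of fields and $\mathbb{T}$ a system of $\mathbf{C}$-valued action exponentials. Let $M,N$ be closed $n$-manifolds and $z_M\in Z(M)$, $z_N\in Z(N)$. If $\mathbb{T}$ is cylindrically firm, then $$\pi_{M\sqcup N}(z_M\,\widehat{\otimes}_m\,z_N)=\pi_M(z_M)\,\widehat{\otimes}_m\,\pi_N(z_N).$$
   Context: A semiring $(S,+,\cdot,0,1)$ consists of a commutative monoid $(S,+,0)$ and a (not necessarily commutative) monoid $(S,\cdot,1)$ such that $\cdot$ distributes over $+$ from both sides and $0$ is absorbing. A complete monoid is a commutative monoid $(M,+,0)$ with a summation law assigning to every family $(m_i)_{i\in I}$, $I$ an arbitrary set, an element $\sum_{i\in I}m_i$ such that $\sum_{i\in\varnothing}m_i=0$, $\sum_{i\in\{1\}}m_i=m_1$, $\sum_{i\in\{1,2\}}m_i=m_1+m_2$, and $\sum_{j\in J}\big(\sum_{i\in I_j}m_i\big)=\sum_{i\in I}m_i$ for every partition $I=\bigcup_{j\in J}I_j$. A semiring is complete if $(S,+,0,\sum)$ is a complete monoid and $\sum_i ss_i=s\sum_i s_i$, $\sum_i s_is=(\sum_i s_i)s$. $Q=Q_S(\mathbf{C})$ is the complete monoid of functions $\operatorname{Mor}(\mathbf{C})\to S$ with pointwise addition and summation. It carries two complete semiring structures: $Q^c=(Q,+,\cdot,0,1)$ with $(a\cdot b)(\gamma)=\sum_{\beta\circ\alpha=\gamma}b(\beta)a(\alpha)$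 and $1$ the characteristic function of the set of identity morphisms; $Q^m=(Q,+,\times,0,1^\times)$ with $(a\times b)(\gamma)=\sum_{\alpha\otimes\beta=\gamma}b(\beta)a(\alpha)$ and $1^\times$ the characteristic function of $\operatorname{id}_I$. Fix an integer $n\ge 0$. Manifolds are topological and need not be orientable; $\varnothing$ is a manifold of every dimension; $\sqcup$ is the ordered disjoint union. A bordism from $M$ to $N$ is a triple $(W,M,N)$ (often abbreviated $W$) with $W$ a compact $(n+1)$-dimensional topological manifold, $\partial W=M\sqcup N$, where the closed $n$-manifolds $M,N$ are the incoming and outgoing boundary. $(W,M,N)\sqcup(W',M',N')=(W\sqcup W',M\sqcup M',N\sqcup N')$. If $W'$ is a bordism from $M$ to $N$ and $W''$ a bordism from $N$ to $P$, gluing along $N$ yields the bordism $W'\cup_N W''$ from $M$ to $P$. A homeomorphism of bordisms is a homeomorphism preserving incoming and outgoing boundaries. $(W_0,M_0,N_0)$ is a subbordism of $(W,M,N)$ if $W_0\subset W$ is a codimension $0$ submanifold, every connected component $C$ of $M_0$ satisfies $C\cap\partial W=\varnothing$ or $C\subset M$, and every connected component $C$ of $N_0$ satisfies $C\cap\partial W=\varnothing$ or $C\subset N$. A system $\mathcal{F}$ of fields assigns to each bordism $W$ a set $\mathcal{F}(W)$ and to each closed $n$-manifold $M$ a set $\mathcal{F}(M)$, with $\mathcal{F}(\varnothing)$ a one-element set, such that: (FRES) There are restriction maps $\mathcal{F}(W)\to\mathcal{F}(W_0)$ for subbordisms $W_0\subset W$, $\mathcal{F}(M)\to\mathcal{F}(M_0)$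 for codimension $0$ submanifolds $M_0\subset M$, and $\mathcal{F}(W)\to\mathcal{F}(M)$ for closed codimension $1$ submanifolds $M\subset W$; they are written $f\mapsto f|_{(-)}$ and commute with each other in the obvious way (restricting in stages equals restricting directly). (FHOMEO) A homeomorphism of bordisms $\phi:W\to W'$ induces a bijection $\phi^*:\mathcal{F}(W')\to\mathcal{F}(W)$ with $(\operatorname{id}_W)^*=\operatorname{id}$, $(\psi\circ\phi)^*=\phi^*\circ\psi^*$; similarly for homeomorphisms of closed $n$-manifolds; these maps commute with the restriction maps. (FDISJ) The products of restrictions $\mathcal{F}(W\sqcup W')\to\mathcal{F}(W)\times\mathcal{F}(W')$ and $\mathcal{F}(M\sqcup N)\to\mathcal{F}(M)\times\mathcal{F}(N)$ are bijections. (FGLUE) For $W=W'\cup_N W''$, the map $\mathcal{F}(W)\to\mathcal{F}(W')\times_{\mathcal{F}(N)}\mathcal{F}(W'')$ given by the restrictions to $W'$ and $W''$ is a bijection onto the pullback. A system $\mathbb{T}$ of $\mathbf{C}$-valued action exponentials consists of functions $\mathbb{T}_W:\mathcal{F}(W)\to\operatorname{Mor}(\mathbf{C})$ for all bordisms $W$ with $\mathbb{T}_\varnothing(p)=\operatorname{id}_I$ ($p$ the unique element of $\mathcal{F}(\varnothing)$) such that: (TDISJ) $\mathbb{T}_{W\sqcup W'}(f)=\mathbb{T}_W(f|_W)\otimes\mathbb{T}_{W'}(f|_{W'})$; (TGLUE) for $W=W'\cup_NW''$, $\mathbb{T}_W(f)=\mathbb{T}_{W''}(f|_{W''})\circ\mathbb{T}_{W'}(f|_{W'})$;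 (THOMEO) for a homeomorphism of bordisms $\phi:W\to W'$ and $f\in\mathcal{F}(W')$, $\mathbb{T}_W(\phi^*f)=\mathbb{T}_{W'}(f)$. Cylinders $M\times[0,1]$ are regarded as bordisms from $M\times 0$ to $M\times 1$, both identified with $M$. For morphisms $\gamma,\xi',\xi''$ of $\mathbf{C}$ put $CTC(\gamma;\xi',\xi'')=\{(\eta',\eta'')\in\operatorname{Mor}(\mathbf{C})^2\mid(\eta'\circ\xi')\otimes(\eta''\circ\xi'')=\gamma\}$ and $TCT(\gamma;\xi',\xi'')=\{(\eta',\eta'')\in\operatorname{Mor}(\mathbf{C})^2\mid(\eta'\otimes\eta'')\circ(\xi'\otimes\xi'')=\gamma\}$ (membership includes that the composites are defined). $\mathbb{T}$ is cylindrically firm if $CTC(\gamma;\mathbb{T}_{M\times[0,1]}(F_M),\mathbb{T}_{N\times[0,1]}(F_N))=TCT(\gamma;\mathbb{T}_{M\times[0,1]}(F_M),\mathbb{T}_{N\times[0,1]}(F_N))$ for all morphisms $\gamma$, all closed $n$-manifolds $M,N$ and all fields $F_M\in\mathcal{F}(M\times[0,1])$, $F_N\in\mathcal{F}(N\times[0,1])$. For a closed $n$-manifold $M$, the state module $Z(M)$ is the set of functions $z:\mathcal{F}(M)\to Q$ with $z(\phi^*f)=z(f)$ for all $f$ and all homeomorphisms $\phi:M\to M$ isotopic to the identity. For $z\in Z(M)$, $z'\in Z(N)$, the element $z\,\widehat{\otimes}_m\,z'\in Z(M)\,\widehat{\otimes}\,Z(N)\cong Z(M\sqcup N)$ is, as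 a function on $\mathcal{F}(M\sqcup N)$, $f\mapsto z(f|_M)\times z'(f|_N)$. For a bordism $W$ and $F\in\mathcal{F}(W)$, $T_W(F)\in Q$ is the characteristic function of the morphism $\mathbb{T}_W(F)$ (value $1\in S$ at $\mathbb{T}_W(F)$, $0$ elsewhere). For $f\in\mathcal{F}(\partial W)$ let $\mathcal{F}(W,f)=\{F\in\mathcal{F}(W)\mid F|_{\partial W}=f\}$. The state sum $Z_W\in Z(\partial W)$ is $Z_W(f)=\sum_{F\in\mathcal{F}(W,f)}T_W(F)\in Q$; for $W$ a bordism from $M$ to $N$ we write $Z_W(f,g)$ for its value on the field of $\partial W=M\sqcup N$ corresponding to $(f,g)\in\mathcal{F}(M)\times\mathcal{F}(N)$. The projection $\pi_M:Z(M)\to Z(M)$ is $$\pi_M(z)(f)=\sum_{h\in\mathcal{F}(M\times 1)}Z_{M\times[0,1]}(f,h)\cdot z(h),\qquad f\in\mathcal{F}(M\times 0),$$ with product in $Q^c$. *)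

(* Defs.v *)
From HB Require Import structures.
From mathcomp Require Import all_boot all_order all_algebra.
From mathcomp Require Import all_classical all_reals topology normedtype.

Set Implicit Arguments.
Unset Strict Implicit.
Unset Printing Implicit Defensive.

Import Order.TTheory GRing.Theory Num.Theory.
Import numFieldNormedType.Exports.

Local Open Scope classical_set_scope.
Local Open Scope ring_scope.

HB.mixin Record isCompleteMonoid M of GRing.Nmodule M := {
  csum : forall I : Type, (I -> M) -> M;
  csum_empty : forall (I : Type) (m : I -> M), (I -> False) -> csum I m = 0;
  csum_single : forall (I : Type) (i : I) (m : I -> M),
    (forall k, k = i) -> csum I m = m i;
  csum_pair : forall (I : Type) (i j : I) (m : I -> M),
    i <> j -> (forall k, k = i \/ k = j) -> csum I m = m i + m j;
  (* A partition of [I] indexed by [J] is the family of fibres of a map. *)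
  csum_partition : forall (I J : Type) (p : I -> J) (m : I -> M),
    csum J (fun j => csum {i | p i = j} (fun i => m (sval i))) = csum I m }.

#[short(type="completeMonoidType")]
HB.structure Definition CompleteMonoid :=
  {M of GRing.Nmodule M & isCompleteMonoid M}.

Arguments csum {M I} m : rename.

HB.mixin Record isCompleteSemiRing S
    of GRing.PzSemiRing S & CompleteMonoid S := {
  csum_distrl : forall (I : Type) (s : S) (m : I -> S),
    csum (fun i => s * m i) = s * csum m;
  csum_distrr : forall (I : Type) (s : S) (m : I -> S),
    csum (fun i => m i * s) = csum m * s }.

#[short(type="completeSemiRingType")]
HB.structure Definition CompleteSemiRing :=
  {S of GRing.PzSemiRing S & CompleteMonoid S & isCompleteSemiRing S}.

(* [comp g f] is only meaningful when [cod f = dom g]; see [is_comp]. *)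
Record strictMonCat := StrictMonCat {
  ob : Type;
  mor : Type;
  dom : mor -> ob;
  cod : mor -> ob;
  idm : ob -> mor;
  comp : mor -> mor -> mor;
  dom_id : forall X, dom (idm X) = X;
  cod_id : forall X, cod (idm X) = X;
  dom_comp : forall g f, cod f = dom g -> dom (comp g f) = dom f;
  cod_comp : forall g f, cod f = dom g -> cod (comp g f) = cod g;
  comp_idl : forall f, comp (idm (cod f)) f = f;
  comp_idr : forall f, comp f (idm (dom f)) = f;
  comp_assoc : forall h g f, cod f = dom g -> cod g = dom h ->
    comp h (comp g f) = comp (comp h g) f;
  unit_ob : ob;
  tens_ob : ob -> ob -> ob;
  tens : mor -> mor -> mor;
  dom_tens : forall f g, dom (tens f g) = tens_ob (dom f) (dom g);
  cod_tens : forall f g, cod (tens f g) = tens_ob (cod f) (cod g);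
  tens_id : forall X Y, tens (idm X) (idm Y) = idm (tens_ob X Y);
  tens_comp : forall g f g' f', cod f = dom g -> cod f' = dom g' ->
    tens (comp g f) (comp g' f') = comp (tens g g') (tens f f');
  tens_obA : forall X Y Z,
    tens_ob X (tens_ob Y Z) = tens_ob (tens_ob X Y) Z;
  tens_ob_unitl : forall X, tens_ob unit_ob X = X;
  tens_ob_unitr : forall X, tens_ob X unit_ob = X;
  tensA : forall f g h, tens f (tens g h) = tens (tens f g) h;
  tens_unitl : forall f, tens (idm unit_ob) f = f;
  tens_unitr : forall f, tens f (idm unit_ob) = f }.

Section Convolution.
Variables (C : strictMonCat) (S : completeSemiRingType).

Definition is_comp (g f h : mor C) : Prop := cod f = dom g /\ comp g f = h.

Definition Q : Type := mor C -> S.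

(* In Q^c and Q^m the second argument is evaluated at the left factor of a
   composite, respectively at the right factor of a tensor product. *)
Definition mulc (a b : Q) : Q := fun gamma =>
  csum (fun p : {p : mor C * mor C | is_comp p.1 p.2 gamma} =>
    b (sval p).1 * a (sval p).2).

Definition mulm (a b : Q) : Q := fun gamma =>
  csum (fun p : {p : mor C * mor C | tens p.1 p.2 = gamma} =>
    b (sval p).2 * a (sval p).1).

Definition sumQ (I : Type) (a : I -> Q) : Q := fun gamma =>
  csum (fun i => a i gamma).

Definition charQ (xi : mor C) : Q := fun gamma =>
  if `[< gamma = xi >] then 1 else 0.

Definition CTC (gamma xi' xi'' : mor C) : set (mor C * mor C) :=
  [set e | exists h' h'', [/\ is_comp e.1 xi' h', is_comp e.2 xi'' h''
                            & tens h' h'' = gamma]].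

Definition TCT (gamma xi' xi'' : mor C) : set (mor C * mor C) :=
  [set e | is_comp (tens e.1 e.2) (tens xi' xi'') gamma].

End Convolution.

Section Embeddings.
Implicit Types S T : topologicalType.

Definition homeomorphism S T (f : S -> T) : Prop :=
  continuous f /\ exists g : T -> S, [/\ continuous g, cancel f g & cancel g f].

Definition embedding S T (f : S -> T) : Prop :=
  [/\ injective f, continuous f
    & forall U : set S, open U -> exists2 V : set T, open V & U = f @^-1` V].

Record homeo_on S T (A : set S) (B : set T) (f : S -> T) (g : T -> S) : Prop :=
  HomeoOn {
    homeo_on_cont : {within A, continuous f};
    homeo_on_contV : {within B, continuous g};
    homeo_on_sub : forall x, A x -> B (f x);
    homeo_on_subV : forall y, B y -> A (g y);
    homeo_onK : forall x, A x -> g (f x) = x;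
    homeo_onKV : forall y, B y -> f (g y) = y }.

Lemma continuous_compose S T T' (f : S -> T) (g : T -> T') :
  continuous f -> continuous g -> continuous (g \o f).
Proof. by move=> cf cg x; apply: continuous_comp; [exact: cf|exact: cg]. Qed.

Lemma homeomorphism_embedding S T (f : S -> T) :
  homeomorphism f -> embedding f.
Proof.
move=> [cf [g [cg fK gK]]]; split=> //; first exact: can_inj fK.
move=> U oU; exists (g @^-1` U).
  by move/continuousP: cg; apply.
by apply/seteqP; split=> x /=; rewrite fK.
Qed.

Lemma compact_embedding S T (f : S -> T) :
  compact [set: S] -> hausdorff_space T -> continuous f -> injective f ->
  embedding f.
Proof.
move=> cS hT cf injf; split=> // U oU.
exists (~` (f @` (~` U))).
  apply: closed_openC; apply: compact_closed => //.
  apply: continuous_compact; first exact: continuous_subspaceT.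
  apply: (@subclosed_compact _ _ [set: S]) => //.
  exact: open_closedC.
apply/seteqP; split=> x /=.
  by move=> Ux [y nUy /injf yx]; apply: nUy; rewrite yx.
by move=> h; apply: contrapT => nUx; apply: h; exists x.
Qed.

Lemma embedding_comp S T T' (f : S -> T) (g : T -> T') :
  embedding f -> embedding g -> embedding (g \o f).
Proof.
move=> [fi fc fo] [gi gc go]; split.
- exact: inj_comp.
- by move=> x; apply: continuous_comp; [exact: fc|exact: gc].
- move=> U /fo[V oV ->]; have [V' oV' ->] := go V oV.
  by exists V'.
Qed.

Lemma withinP S T (A : set S) (f : S -> T) :
  {within A, continuous f} <->
  forall x, A x -> forall O, open O -> O (f x) ->
    exists N, [/\ open N, N x & forall y, N y -> A y -> O (f y)].
Proof.
split.
  move=> /subspace_continuousP h x Ax O oO Ofx.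
  have := h x Ax O (open_nbhs_nbhs (conj oO Ofx)).
  rewrite /= nbhs_simpl /within /= nbhsE => -[N [oN Nx] NA].
  by exists N; split=> // y Ny Ay; exact: NA.
move=> h; apply/subspace_continuousP => x Ax O.
rewrite nbhsE => -[O' [oO' O'fx] sO].
have [N [oN Nx NA]] := h x Ax O' oO' O'fx.
rewrite /= nbhs_simpl /within /= nbhsE; exists N => //.
by move=> y Ny Ay; apply/sO/NA.
Qed.

Lemma within_comp S T T' (A : set S) (B : set T) (f : S -> T) (g : T -> T') :
  {within A, continuous f} -> {within B, continuous g} ->
  (forall x, A x -> B (f x)) -> {within A, continuous (g \o f)}.
Proof.
move=> /withinP cf /withinP cg AB; apply/withinP => x Ax O oO Ogfx.
have [N [oN Nfx NO]] := cg _ (AB x Ax) O oO Ogfx.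
have [N' [oN' N'x N'N]] := cf x Ax N oN Nfx.
exists N'; split=> // y N'y Ay; apply: NO; first exact: N'N.
exact: AB.
Qed.

Lemma inj_hausdorff S T (f : S -> T) :
  continuous f -> injective f -> hausdorff_space T -> hausdorff_space S.
Proof.
move=> cf fi hT p q pq; apply: fi; apply: hT => A B Ap Bq.
have [z [/= Az Bz]] := pq _ _ (cf p A Ap) (cf q B Bq).
by exists (f z).
Qed.

Lemma prod_hausdorff S T :
  hausdorff_space S -> hausdorff_space T -> hausdorff_space (S * T)%type.
Proof.
move=> hS hT [p p'] [q q'] pq; congr (_, _).
  apply: hS => A B Ap Bq.
  have [[z z'] [/= Az Bz]] := pq _ _
    (@cvg_fst _ _ (nbhs p) (nbhs p') _ A Ap) (@cvg_fst _ _ (nbhs q) (nbhs q') _ B Bq).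
  by exists z.
apply: hT => A B Ap Bq.
have [[z z'] [/= Az Bz]] := pq _ _
    (@cvg_snd _ _ (nbhs p) (nbhs p') _ A Ap) (@cvg_snd _ _ (nbhs q) (nbhs q') _ B Bq).
by exists z'.
Qed.

Lemma fst_continuous S T : continuous (@fst S T).
Proof. by move=> p; exact: cvg_fst. Qed.

Lemma snd_continuous S T : continuous (@snd S T).
Proof. by move=> p; exact: cvg_snd. Qed.

Lemma pair_continuous S T T' (f : S -> T) (g : S -> T') :
  continuous f -> continuous g -> continuous (fun x => (f x, g x)).
Proof. by move=> cf cg x; apply: cvg_pair; [exact: cf|exact: cg]. Qed.

Lemma mx_continuous S T m k (f : S -> 'M[T]_(m, k)) :
  (forall i j, continuous (fun x => f x i j)) -> continuous f.
Proof.
move=> cf x A [P hP sPA]; apply: (@filterS _ (nbhs x) _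
  [set y | forall i j, P i j (f y i j)]); first by move=> y; exact: sPA.
apply: filter_forall => i; apply: filter_forall => j.
exact: cf i j x _ (hP i j).
Qed.

End Embeddings.

Section Sum.
Implicit Types X Y Z : topologicalType.

(* The ordered disjoint union; the left summand is tagged by [false]. *)
Definition sumt X Y : topologicalType :=
  {b : bool & (if b then Y else X : topologicalType)}.

Definition inL X Y (x : X) : sumt X Y :=
  existT (fun b : bool => (if b then Y else X : topologicalType)) false x.

Definition inR X Y (y : Y) : sumt X Y :=
  existT (fun b : bool => (if b then Y else X : topologicalType)) true y.

Definition copair X Y (Z : Type) (f : X -> Z) (g : Y -> Z) (s : sumt X Y) : Z :=
  let: existT b u := s in
  (if b return (if b then Y else X : topologicalType) -> Z then g else f) u.

Lemma sumtP X Y (P : sumt X Y -> Prop) :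
  (forall x, P (inL Y x)) -> (forall y, P (inR X y)) -> forall s, P s.
Proof. by move=> PL PR [[] u]; [exact: PR|exact: PL]. Qed.

Lemma inL_continuous X Y : continuous (@inL X Y).
Proof.
exact: (@existT_continuous _
  (fun b : bool => (if b then Y else X : topologicalType)) false).
Qed.

Lemma inR_continuous X Y : continuous (@inR X Y).
Proof.
exact: (@existT_continuous _
  (fun b : bool => (if b then Y else X : topologicalType)) true).
Qed.

Lemma inL_open X Y (A : set X) : open A -> open (@inL X Y @` A).
Proof.
exact: (@existT_open_map _
  (fun b : bool => (if b then Y else X : topologicalType)) false).
Qed.

Lemma inR_open X Y (A : set Y) : open A -> open (@inR X Y @` A).
Proof.
exact: (@existT_open_map _
  (fun b : bool => (if b then Y else X : topologicalType)) true).
Qed.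

Lemma inL_inj X Y : injective (@inL X Y).
Proof.
by move=> x y /(congr1 (copair (@Some X) (fun=> None))) [].
Qed.

Lemma inR_inj X Y : injective (@inR X Y).
Proof.
by move=> x y /(congr1 (copair (fun=> None) (@Some Y))) [].
Qed.

Lemma inLR X Y (x : X) (y : Y) : inL Y x <> inR X y.
Proof. by move=> /(congr1 (copair (fun=> true) (fun=> false))). Qed.

Lemma copair_continuous X Y Z (f : X -> Z) (g : Y -> Z) :
  continuous f -> continuous g -> continuous (copair f g).
Proof.
move=> cf cg.
pose h (b : bool) : (if b then Y else X : topologicalType) -> Z :=
  if b return (if b then Y else X : topologicalType) -> Z then g else f.
have -> : copair f g = unstable.sigT_fun h by apply/funext => -[[] u].
by apply: sigT_continuous => -[].
Qed.

Lemma sumt_compact X Y :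
  compact [set: X] -> compact [set: Y] -> compact [set: sumt X Y].
Proof. by move=> cX cY; apply: sigT_compact => //= -[]. Qed.

Lemma sumt_hausdorff X Y :
  hausdorff_space X -> hausdorff_space Y -> hausdorff_space (sumt X Y).
Proof. by move=> hX hY; apply: sigT_hausdorff => -[]. Qed.

End Sum.
Arguments inL {X} Y x.
Arguments inR X {Y} y.

Definition open_map (S T : topologicalType) (f : S -> T) :=
  forall U : set S, open U -> open (f @` U).

Lemma open_map_embedding (S T : topologicalType) (f : S -> T) :
  injective f -> continuous f -> open_map f -> embedding f.
Proof.
move=> fi fc fo; split=> // U oU; exists (f @` U); first exact: fo.
apply/seteqP; split=> x /=; first by exists x.
by move=> [y Uy /fi <-].
Qed.

Section Charts.
Variable R : realType.

Definition locally_euclidean (m : nat) (T : topologicalType) : Prop :=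
  forall x : T, exists (U : set T) (V : set 'rV[R]_m) f g,
    [/\ open U, U x, open V & homeo_on U V f g].

Definition halfspace (n : nat) : set 'rV[R]_n.+1 :=
  [set v | 0 <= v ord0 ord0].

(* Around [x], the pair [(T, B)] looks like an open piece of the pair
   [(E, E `&` {v | v_0 = 0})]. *)
Definition flat_at (n : nat) (E : set 'rV[R]_n.+1) (T : topologicalType)
    (B : set T) (x : T) : Prop :=
  exists (U : set T) (V : set 'rV[R]_n.+1) f g,
    [/\ open U, U x, open V, homeo_on U (V `&` E) f g
      & forall y, U y -> B y <-> f y ord0 ord0 = 0].

Lemma homeo_on_transport (S T P : topologicalType) (p0 : P) (i : S -> T)
    (U : set S) (V : set P) f g :
  injective i -> continuous i -> open_map i -> open U ->
  homeo_on U V f g ->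
  exists f', homeo_on (i @` U) V f' (i \o g) /\ forall x, f' (i x) = f x.
Proof.
move=> ii ci oi oU [cf cg sf sg fK gK].
pose f' z := if pselect (exists x, i x = z) is left h
             then f (projT1 (cid h)) else p0.
have f'i x : f' (i x) = f x.
  rewrite /f'; case: pselect => [h|]; last by case; exists x.
  by case: cid => y /= /ii ->.
exists f'; split; last exact: f'i.
split.
- apply/withinP => _ [x Ux <-] O oO; rewrite f'i => Ofx.
  move/withinP: cf => /(_ x Ux O oO Ofx)[N [oN Nx NO]].
  exists (i @` N); split; [exact: oi|by exists x|].
  by move=> _ [y Ny <-] [y' Uy' /ii yy']; rewrite f'i; apply: NO => //; rewrite -yy'.
- apply/withinP => v Vv O oO Oigv.
  have oO' : open (i @^-1` O) by move/continuousP: ci; apply.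
  move/withinP: cg => /(_ v Vv _ oO' Oigv)[N [oN Nv NO]].
  by exists N.
- by move=> _ [x Ux <-]; rewrite f'i; exact: sf.
- by move=> v Vv; exists (g v) => //; exact: sg.
- by move=> _ [x Ux <-] /=; rewrite f'i fK.
- by move=> v Vv /=; rewrite f'i gK.
Qed.

Lemma flat_at_transport n (E : set 'rV[R]_n.+1) (S T : topologicalType)
    (i : S -> T) (B : set S) (B' : set T) x :
  injective i -> continuous i -> open_map i ->
  (forall y, B' (i y) <-> B y) -> flat_at E B x -> flat_at E B' (i x).
Proof.
move=> ii ci oi BB' [U [V [f [g [oU Ux oV h hB]]]]].
have [f' [h' f'i]] := homeo_on_transport (f x) ii ci oi oU h.
exists (i @` U), V, f', (i \o g); split=> //.
  exact: oi oU.
by move=> _ [y Uy <-]; rewrite f'i; apply: iff_trans (BB' y) (hB y Uy).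
Qed.

Lemma flat_at_shrink n (E : set 'rV[R]_n.+1) (T : topologicalType)
    (B B' : set T) x (O : set T) : open O -> O x ->
  (forall y, O y -> B' y <-> B y) -> flat_at E B x -> flat_at E B' x.
Proof.
move=> oO Ox BB' [U [V [f [g [oU Ux oV [cf cg sf sg fK gK] hB]]]]].
have : open (g @^-1` O : set (subspace (V `&` E))).
  by move/continuousP: cg; apply.
move=> /open_subspaceP[V' oV' V'E].
have V'P v : V v -> E v -> V' v <-> O (g v).
  move=> Vv Ev; split=> h.
    have : (V' `&` (V `&` E)) v by [].
    by rewrite V'E => -[].
  have : (g @^-1` O `&` (V `&` E)) v by [].
  by rewrite -V'E => -[].
exists (U `&` O), (V `&` V'), f, g; split=> //.
- exact: openI.
- exact: openI.
- split.
  + by apply: continuous_subspaceW cf => y [].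
  + by apply: continuous_subspaceW cg => y [[]].
  + move=> y [Uy Oy]; have [Vfy Efy] := sf _ Uy; split=> //; split=> //.
    by apply/V'P => //; rewrite fK.
  + move=> v [[Vv V'v] Ev]; split; first exact: sg.
    exact/V'P.
  + by move=> y [Uy _]; exact: fK.
  + by move=> v [[Vv V'v] Ev]; exact: gK.
- by move=> y [Uy Oy]; apply: iff_trans (BB' y Oy) (hB y Uy).
Qed.

End Charts.

Section Manifolds.
Variables (R : realType) (n : nat).

(* A compact Hausdorff locally Euclidean space is second countable. *)
Record closedMfd := ClosedMfd {
  mfd_space :> topologicalType;
  mfd_compact : compact [set: mfd_space];
  mfd_hausdorff : hausdorff_space mfd_space;
  mfd_euclidean : @locally_euclidean R n mfd_space }.

Lemma sumt_euclidean (X Y : topologicalType) :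
  @locally_euclidean R n X -> @locally_euclidean R n Y ->
  @locally_euclidean R n (sumt X Y).
Proof.
move=> hX hY s; elim/sumtP: s => [x|y].
  have [U [V [f [g [oU Ux oV h]]]]] := hX x.
  have [f' [h' _]] := homeo_on_transport (f x) (@inL_inj X Y)
    (@inL_continuous X Y) (@inL_open X Y) oU h.
  exists (inL Y @` U), V, f', (inL Y \o g); split=> //; first exact: inL_open.
have [U [V [f [g [oU Uy oV h]]]]] := hY y.
have [f' [h' _]] := homeo_on_transport (f y) (@inR_inj X Y)
  (@inR_continuous X Y) (@inR_open X Y) oU h.
exists (inR X @` U), V, f', (inR X \o g); split=> //; first exact: inR_open.
Qed.

Definition mfd_sum (M N : closedMfd) : closedMfd :=
  ClosedMfd (sumt_compact (@mfd_compact M) (@mfd_compact N))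
    (sumt_hausdorff (@mfd_hausdorff M) (@mfd_hausdorff N))
    (sumt_euclidean (@mfd_euclidean M) (@mfd_euclidean N)).

(* A bordism from [M] to [N]: [bd_map] identifies [M] + [N] with the boundary.
   The charts are charts of the pair (space, boundary) modelled on the pair
   (half-space, bounding hyperplane). By invariance of domain, the image of
   [bd_map] is then the set of points without a Euclidean neighbourhood. *)
Record bordism (M N : closedMfd) := Bordism {
  bd_space :> topologicalType;
  bd_compact : compact [set: bd_space];
  bd_hausdorff : hausdorff_space bd_space;
  bd_map : mfd_sum M N -> bd_space;
  bd_embedding : embedding bd_map;
  bd_flat : forall x : bd_space, flat_at (@halfspace R n) (range bd_map) x }.

Definition bd_in (M N : closedMfd) (W : bordism M N) : M -> W :=
  @bd_map M N W \o inL N.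

Definition bd_out (M N : closedMfd) (W : bordism M N) : N -> W :=
  @bd_map M N W \o inR M.

Lemma bd_map_continuous (M N : closedMfd) (W : bordism M N) :
  continuous (@bd_map M N W).
Proof. by have [] := @bd_embedding M N W. Qed.

Lemma bd_map_inj (M N : closedMfd) (W : bordism M N) :
  injective (@bd_map M N W).
Proof. by have [] := @bd_embedding M N W. Qed.

Lemma bd_in_continuous (M N : closedMfd) (W : bordism M N) :
  continuous (@bd_in M N W).
Proof.
exact: continuous_compose (@inL_continuous M N) (@bd_map_continuous _ _ W).
Qed.

Lemma bd_out_continuous (M N : closedMfd) (W : bordism M N) :
  continuous (@bd_out M N W).
Proof.
exact: continuous_compose (@inR_continuous M N) (@bd_map_continuous _ _ W).
Qed.

Lemma bd_in_inj (M N : closedMfd) (W : bordism M N) : injective (@bd_in M N W).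
Proof. by move=> x y /bd_map_inj/inL_inj. Qed.

Lemma bd_out_inj (M N : closedMfd) (W : bordism M N) :
  injective (@bd_out M N W).
Proof. by move=> x y /bd_map_inj/inR_inj. Qed.

Lemma bd_in_out (M N : closedMfd) (W : bordism M N) x y :
  bd_in W x <> bd_out W y.
Proof. by move=> /bd_map_inj/inLR. Qed.

Section Sum.
Variables (M N M' N' : closedMfd) (W : bordism M N) (W' : bordism M' N').

Definition bd_sum_map : mfd_sum (mfd_sum M M') (mfd_sum N N') -> sumt W W' :=
  copair (copair (inL W' \o @bd_in M N W) (inR W \o @bd_in M' N' W'))
         (copair (inL W' \o @bd_out M N W) (inR W \o @bd_out M' N' W')).

Lemma bd_sum_mapE s :
  [\/ exists u, s = inL _ (inL _ u) /\ bd_sum_map s = inL _ (bd_in W u),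
      exists u, s = inL _ (inR _ u) /\ bd_sum_map s = inR _ (bd_in W' u),
      exists u, s = inR _ (inL _ u) /\ bd_sum_map s = inL _ (bd_out W u)
    | exists u, s = inR _ (inR _ u) /\ bd_sum_map s = inR _ (bd_out W' u)].
Proof.
elim/sumtP: s => s; elim/sumtP: s => u.
- by apply: Or41; exists u.
- by apply: Or42; exists u.
- by apply: Or43; exists u.
- by apply: Or44; exists u.
Qed.

Lemma range_bd_sum_mapL w :
  range bd_sum_map (inL W' w) <-> range (@bd_map _ _ W) w.
Proof.
split.
  move=> [s _]; case: (bd_sum_mapE s) => -[u [_ ->]].
  - by move=> /inL_inj <-; exists (inL N u).
  - by move=> /esym/inLR.
  - by move=> /inL_inj <-; exists (inR M u).
  - by move=> /esym/inLR.
move=> [s _ <-]; elim/sumtP: s => u.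
  by exists (inL _ (inL _ u)).
by exists (inR _ (inL _ u)).
Qed.

Lemma range_bd_sum_mapR w :
  range bd_sum_map (inR W w) <-> range (@bd_map _ _ W') w.
Proof.
split.
  move=> [s _]; case: (bd_sum_mapE s) => -[u [_ ->]].
  - by move=> /inLR.
  - by move=> /inR_inj <-; exists (inL N' u).
  - by move=> /inLR.
  - by move=> /inR_inj <-; exists (inR M' u).
move=> [s _ <-]; elim/sumtP: s => u.
  by exists (inL _ (inR _ u)).
by exists (inR _ (inR _ u)).
Qed.

Lemma bd_sum_embedding : embedding bd_sum_map.
Proof.
apply: compact_embedding.
- exact: mfd_compact.
- by apply: sumt_hausdorff; exact: bd_hausdorff.
- apply: copair_continuous; apply: copair_continuous;
    apply: continuous_compose.
  + exact: bd_in_continuous.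
  + exact: inL_continuous.
  + exact: bd_in_continuous.
  + exact: inR_continuous.
  + exact: bd_out_continuous.
  + exact: inL_continuous.
  + exact: bd_out_continuous.
  + exact: inR_continuous.
- move=> s s'.
  case: (bd_sum_mapE s) => -[u [-> ->]];
    case: (bd_sum_mapE s') => -[u' [-> ->]].
  + by move=> /inL_inj/bd_in_inj ->.
  + by move=> /inLR.
  + by move=> /inL_inj/bd_in_out.
  + by move=> /inLR.
  + by move=> /esym/inLR.
  + by move=> /inR_inj/bd_in_inj ->.
  + by move=> /esym/inLR.
  + by move=> /inR_inj/bd_in_out.
  + by move=> /inL_inj/esym/bd_in_out.
  + by move=> /inLR.
  + by move=> /inL_inj/bd_out_inj ->.
  + by move=> /inLR.
  + by move=> /esym/inLR.
  + by move=> /inR_inj/esym/bd_in_out.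
  + by move=> /esym/inLR.
  + by move=> /inR_inj/bd_out_inj ->.
Qed.

Lemma bd_sum_flat x : flat_at (@halfspace R n) (range bd_sum_map) x.
Proof.
elim/sumtP: x => w.
  exact: (flat_at_transport (@inL_inj _ _) (@inL_continuous _ _)
    (@inL_open _ _) range_bd_sum_mapL (bd_flat w)).
exact: (flat_at_transport (@inR_inj _ _) (@inR_continuous _ _)
  (@inR_open _ _) range_bd_sum_mapR (bd_flat w)).
Qed.

Definition bd_sum : bordism (mfd_sum M M') (mfd_sum N N') :=
  Bordism (sumt_compact (@bd_compact _ _ W) (@bd_compact _ _ W'))
    (sumt_hausdorff (@bd_hausdorff _ _ W) (@bd_hausdorff _ _ W'))
    bd_sum_embedding bd_sum_flat.

End Sum.

Section Interval.

Definition itv01 : topologicalType := set_type (`[0, 1]%classic : set R).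

Lemma itv01P (r : R) : 0 <= r -> r <= 1 -> r \in (`[0, 1]%classic : set R).
Proof. by move=> r0 r1; rewrite inE /= in_itv /= r0 r1. Qed.

Definition mk01 (r : R) (r0 : 0 <= r) (r1 : r <= 1) : itv01 :=
  exist _ r (itv01P r0 r1).

Definition itv0 : itv01 := mk01 (lexx 0) ler01.
Definition itv1 : itv01 := mk01 ler01 (lexx 1).

Definition itv_val (t : itv01) : R := set_val t.

Lemma itv_val_ge0 t : 0 <= itv_val t.
Proof.
by case: t => r hr; rewrite /itv_val set_valE /=; move: hr; rewrite inE /= in_itv /= => /andP[].
Qed.

Lemma itv_val_le1 t : itv_val t <= 1.
Proof.
by case: t => r hr; rewrite /itv_val set_valE /=; move: hr; rewrite inE /= in_itv /= => /andP[].
Qed.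

Lemma itv_val_inj : injective itv_val.
Proof. by move=> x y; rewrite /itv_val !set_valE => /val_inj. Qed.

Lemma itv_valK r r0 r1 : itv_val (@mk01 r r0 r1) = r.
Proof. by rewrite /itv_val set_valE. Qed.

Lemma itv_val_continuous : continuous itv_val.
Proof. exact: initial_continuous. Qed.

Lemma itv_openP (O : set itv01) :
  open O <-> exists2 O' : set R, open O' & O = itv_val @^-1` O'.
Proof.
by split => -[O' oO' h]; exists O'; rewrite // h.
Qed.

Lemma itv01_hausdorff : hausdorff_space itv01.
Proof.
exact: inj_hausdorff itv_val_continuous itv_val_inj (@Rhausdorff R).
Qed.

Lemma flip_ge0 t : 0 <= 1 - itv_val t.
Proof. by rewrite subr_ge0 itv_val_le1. Qed.

Lemma flip_le1 t : 1 - itv_val t <= 1.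
Proof. by rewrite gerBl itv_val_ge0. Qed.

Definition flip (t : itv01) : itv01 := mk01 (flip_ge0 t) (flip_le1 t).

Lemma flipK : involutive flip.
Proof. by move=> t; apply: itv_val_inj; rewrite !itv_valK opprB addrCA subrr addr0. Qed.

Lemma flip_continuous : continuous flip.
Proof.
apply/continuousP => O /itv_openP[O' oO' ->].
have -> : flip @^-1` (itv_val @^-1` O') =
    (fun t => 1 - itv_val t) @^-1` O'.
  by apply/seteqP; split=> t /=; rewrite itv_valK.
move: O' oO'; apply/continuousP => t.
by apply: continuousB; [exact: cst_continuous|exact: itv_val_continuous].
Qed.

Definition clamp (r : R) : itv01 :=
  if pselect (0 <= r /\ r <= 1) is left h then mk01 h.1 h.2 else itv0.

Lemma clampK r : 0 <= r -> r <= 1 -> itv_val (clamp r) = r.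
Proof.
by move=> r0 r1; rewrite /clamp; case: pselect => [h|[]//]; rewrite itv_valK.
Qed.

Lemma itv_valC t : clamp (itv_val t) = t.
Proof. by apply: itv_val_inj; rewrite clampK ?itv_val_ge0 ?itv_val_le1. Qed.

Lemma clamp_continuous : {within `[0, 1]%classic, continuous clamp}.
Proof.
apply/withinP => r; rewrite /= in_itv /= => /andP[r0 r1] O /itv_openP[O' oO' ->].
rewrite /= clampK // => O'r; exists O'; split=> // s O's.
by rewrite in_itv /= => /andP[s0 s1]; rewrite clampK.
Qed.

Lemma itv01_compact : compact [set: itv01].
Proof.
have -> : [set: itv01] = clamp @` `[0, 1]%classic.
  apply/seteqP; split=> // t _; exists (itv_val t); last exact: itv_valC.
  by rewrite /= in_itv /= itv_val_ge0 itv_val_le1.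
by apply: continuous_compact; [exact: clamp_continuous|exact: segment_compact].
Qed.

End Interval.

Section Cylinder.
Variable M : closedMfd.

Definition cyl_space : topologicalType := (M * itv01)%type.

Definition cyl_map : mfd_sum M M -> cyl_space :=
  copair (fun x => (x, itv0)) (fun x => (x, itv1)).

Lemma range_cyl_map (p : cyl_space) :
  range cyl_map p <-> itv_val p.2 = 0 \/ itv_val p.2 = 1.
Proof.
split.
  by move=> [s _ <-]; elim/sumtP: s => x; [left|right]; rewrite /= itv_valK.
case: p => x t /= [] ht.
  by exists (inL M x) => //=; congr (_, _); apply: itv_val_inj; rewrite itv_valK.
by exists (inR M x) => //=; congr (_, _); apply: itv_val_inj; rewrite itv_valK.
Qed.

Lemma cyl_compact : compact [set: cyl_space].
Proof.
rewrite -setXTT; apply: compact_setX; first exact: mfd_compact.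
exact: itv01_compact.
Qed.

Lemma cyl_hausdorff : hausdorff_space cyl_space.
Proof.
by apply: prod_hausdorff; [exact: mfd_hausdorff|exact: itv01_hausdorff].
Qed.

Lemma itv0_neq1 : itv0 <> itv1.
Proof.
by move=> /(congr1 itv_val); rewrite !itv_valK => /esym/eqP; rewrite oner_eq0.
Qed.

Lemma cyl_embedding : embedding cyl_map.
Proof.
apply: compact_embedding.
- exact: mfd_compact.
- exact: cyl_hausdorff.
- by apply: copair_continuous; apply: pair_continuous;
    (exact: cst_continuous || (by move=> u; exact: cvg_id)).
- move=> s s'; elim/sumtP: s => x; elim/sumtP: s' => y /= /pair_equal_spec[-> //].
  + by move=> /itv0_neq1.
  + by move=> /esym/itv0_neq1.
Qed.

Lemma cyl_flat_lt1 (x : M) (t : itv01) : itv_val t < 1 ->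
  flat_at (@halfspace R n) (range cyl_map) ((x, t) : cyl_space).
Proof.
move=> t1.
have [U [V [f [g [oU Ux oV [cf cg sf sg fK gK]]]]]] := @mfd_euclidean M x.
pose tl (v : 'rV[R]_n.+1) : 'rV[R]_n := @rsubmx R 1 1 n v.
pose F (p : cyl_space) : 'rV[R]_n.+1 :=
  row_mx (const_mx (itv_val p.2) : 'rV_1) (f p.1) : 'rV_(1 + n).
pose G (v : 'rV[R]_n.+1) : cyl_space := (g (tl v), clamp (v ord0 ord0)).
have ord0E : ord0 = lshift n (ord0 : 'I_1) :> 'I_(1 + n) by apply: val_inj.
have F0 p : F p ord0 ord0 = itv_val p.2.
  by rewrite [X in F p _ X]ord0E; apply: etrans (row_mxEl _ _ _ _) _; rewrite mxE.
have ctl : continuous tl.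
  apply: mx_continuous => i j.
  have -> : (fun v => tl v i j) = (fun v => v i (rshift 1 j)).
    by apply/funext => v; rewrite /tl mxE.
  exact: coord_continuous.
have c0 : continuous (fun v : 'rV[R]_n.+1 => v ord0 ord0).
  exact: coord_continuous.
have cclamp (A : set 'rV[R]_n.+1) :
    (forall v, A v -> 0 <= v ord0 ord0 <= 1) ->
    {within A, continuous (fun v => clamp (v ord0 ord0))}.
  move=> hA; apply: (within_comp (f := fun v : 'rV[R]_n.+1 => v ord0 ord0)
    _ clamp_continuous).
    exact: continuous_subspaceT.
  by move=> v /hA; rewrite /= in_itv.
have c2 : continuous (fun p : cyl_space => itv_val p.2).
  exact: continuous_compose (@snd_continuous _ _) itv_val_continuous.
have Ftl p : tl (F p) = f p.1 by rewrite /tl row_mxKr.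
exists (fst @^-1` U `&` snd @^-1` (itv_val @^-1` [set r | r < 1])).
exists (tl @^-1` V `&` [set v | v ord0 ord0 < 1]), F, G; split=> //.
- apply: openI; first by move/continuousP: (@fst_continuous M itv01); exact.
  move/continuousP: c2 => /(_ [set r | r < 1]); apply; exact: open_lt.
- apply: openI; first by move/continuousP: ctl; exact.
  by move/continuousP: c0 => /(_ [set r | r < 1]); apply; exact: open_lt.
- split.
  + apply: mx_continuous => i j; rewrite (ord1 i).
    have := erefl (F : cyl_space -> 'rV[R]_(1 + n)); move: j.
    change 'I_n.+1 with 'I_(1 + n) => j _; case: (split_ordP j) => k ->.
      have -> : (fun p => F p ord0 (lshift n k)) = (fun p => itv_val p.2).
        apply/funext => p; apply: etrans (row_mxEl _ _ _ _) _.
        by rewrite mxE.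
      exact: continuous_subspaceT.
    have -> : (fun p => F p ord0 (rshift 1 k)) =
        (fun v : 'rV[R]_n => v ord0 k) \o (f \o fst).
      by apply/funext => p; exact: row_mxEr.
    apply: (@within_comp _ _ _ _ setT); last by [].
      apply: (@within_comp _ _ _ _ U _ _ _ cf); last by move=> p [].
      exact/continuous_subspaceT/fst_continuous.
    exact/continuous_subspaceT/coord_continuous.
  + apply: pair_continuous.
      apply: (@within_comp _ _ _ _ V _ _ _ cg); last by move=> p [[]].
      exact: continuous_subspaceT.
    apply: cclamp => v [[_ v1] v0].
    by apply/andP; split=> //; exact: ltW.
  + move=> [y s] /= [Uy s1]; split; first split=> /=.
    * by rewrite Ftl; exact: sf.
    * by rewrite F0.
    * by rewrite /halfspace /= F0 itv_val_ge0.
  + move=> v [[Vv v1] v0]; split => /=; first exact: sg.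
    by rewrite clampK // ltW.
  + by move=> [y s] [Uy s1]; rewrite /G Ftl F0 itv_valC /= fK.
  + move=> v [[Vv v1] v0].
    rewrite /F /G /= gK // clampK //; last exact: ltW.
    have -> : const_mx (v ord0 ord0) = @lsubmx R 1 1 n v.
      apply/matrixP => i j; rewrite !mxE (ord1 i) (ord1 j); congr (v _ _).
      exact: val_inj.
    by rewrite /tl; exact: (@hsubmxK R 1 1 n v).
- move=> [y s] [Uy s1]; rewrite F0; apply: (iff_trans (range_cyl_map _)) => /=.
  split; last by left.
  by case=> // h; move: s1; rewrite /= h ltxx.
Qed.

Lemma cyl_flat p : flat_at (@halfspace R n) (range cyl_map) p.
Proof.
case: p => x t; have [t1|t1] := ltP (itv_val t) 1; first exact: cyl_flat_lt1.
pose fl (p : cyl_space) : cyl_space := (p.1, flip p.2).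
have flK : involutive fl by move=> [y s]; rewrite /fl /= flipK.
have cfl : continuous fl.
  apply: pair_continuous; first exact: fst_continuous.
  exact: continuous_compose (@snd_continuous _ _) flip_continuous.
have ofl : open_map fl.
  move=> O oO; have -> : fl @` O = fl @^-1` O.
    apply/seteqP; split=> q /=; first by move=> [q' Oq' <-]; rewrite flK.
    by move=> Oq; exists (fl q) => //; rewrite flK.
  by move/continuousP: cfl; apply.
have -> : (x, t) = fl (x, flip t) by rewrite /fl /= flipK.
apply: (flat_at_transport (B := range cyl_map) (inv_inj flK) cfl ofl).
  move=> [y s]; apply: (iff_trans (range_cyl_map _)).
  apply: iff_sym; apply: (iff_trans (range_cyl_map _)) => /=.
  rewrite itv_valK; split=> -[] h.
  - by right; rewrite h subr0.
  - by left; rewrite h subrr.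
  - by right; rewrite -[LHS](subKr 1) h subr0.
  - by left; rewrite -[LHS](subKr 1) h subrr.
apply: cyl_flat_lt1; rewrite itv_valK gtrBl.
exact: lt_le_trans ltr01 t1.
Qed.

Definition cylinder : bordism M M :=
  Bordism cyl_compact cyl_hausdorff cyl_embedding cyl_flat.

End Cylinder.

(* Submanifolds are given by embeddings and, as usual in the topological
   category, are locally flat. The half-space alternative is for submanifolds
   in the boundary. *)
Definition locally_flat (S T : topologicalType) (e : S -> T) : Prop :=
  forall x, flat_at [set: 'rV[R]_n.+1] (range e : set T) (e x) \/
            flat_at (@halfspace R n) (range e : set T) (e x).

Definition submanifold1 (M : closedMfd) (S : topologicalType) (e : M -> S) :
    Prop := embedding e /\ locally_flat e.

(* [W0] is a compact manifold of the same dimension as [W], so the embedding has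
   codimension 0 and local flatness is a condition on the boundary of [W0]. *)
Record subbordism (M0 N0 : closedMfd) (W0 : bordism M0 N0)
    (M N : closedMfd) (W : bordism M N) (e : W0 -> W) : Prop := SubBordism {
  sub_embedding : embedding e;
  sub_flat : locally_flat (e \o @bd_map M0 N0 W0);
  sub_in : forall x : M0,
    let C := e @` (bd_in W0 @` connected_component [set: M0] x) in
    C `&` range (@bd_map M N W) = set0 \/ C `<=` range (@bd_in M N W);
  sub_out : forall y : N0,
    let C := e @` (bd_out W0 @` connected_component [set: N0] y) in
    C `&` range (@bd_map M N W) = set0 \/ C `<=` range (@bd_out M N W) }.

Record bd_homeo (M N : closedMfd) (W : bordism M N) (M' N' : closedMfd)
    (W' : bordism M' N') (phi : W -> W') : Prop := BdHomeo {
  bd_homeo_homeo : homeomorphism phi;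
  bd_homeo_in : phi @` range (@bd_in M N W) = range (@bd_in M' N' W');
  bd_homeo_out : phi @` range (@bd_out M N W) = range (@bd_out M' N' W') }.

(* The gluing of [W'] and [W''] along [N], up to homeomorphism: [W] is compact
   Hausdorff, so it carries the quotient topology of the sum. *)
Record gluing (M N P : closedMfd) (W' : bordism M N) (W'' : bordism N P)
    (W : bordism M P) (i' : W' -> W) (i'' : W'' -> W) : Prop := Gluing {
  gluing_sub' : subbordism i';
  gluing_sub'' : subbordism i'';
  gluing_cover : range i' `|` range i'' = setT;
  gluing_overlap : forall a b, i' a = i'' b <->
    exists y : N, a = bd_out W' y /\ b = bd_in W'' y;
  gluing_in : forall x, i' (bd_in W' x) = bd_in W x;
  gluing_out : forall z, i'' (bd_out W'' z) = bd_out W z }.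

Lemma inL_embedding (M N : closedMfd) :
  embedding (inL N : M -> mfd_sum M N).
Proof.
apply: open_map_embedding; [exact: inL_inj|exact: inL_continuous|].
exact: inL_open.
Qed.

Lemma inR_embedding (M N : closedMfd) :
  embedding (inR M : N -> mfd_sum M N).
Proof.
apply: open_map_embedding; [exact: inR_inj|exact: inR_continuous|].
exact: inR_open.
Qed.

Lemma bd_map_submanifold (M N : closedMfd) (W : bordism M N) :
  submanifold1 (@bd_map M N W).
Proof.
by split=> [|x]; [exact: bd_embedding|right; exact: bd_flat].
Qed.

Lemma range_bd_map (M N : closedMfd) (W : bordism M N) w :
  range (@bd_map M N W) w <-> range (bd_in W) w \/ range (bd_out W) w.
Proof.
split; last by case=> -[x _ <-]; [exists (inL N x)|exists (inR M x)].
by move=> [s _ <-]; elim/sumtP: s => x; [left|right]; exists x.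
Qed.

Lemma closed_range (M : closedMfd) (T : topologicalType) (f : M -> T) :
  hausdorff_space T -> continuous f -> closed (range f).
Proof.
move=> hT cf; apply: compact_closed => //.
by apply: continuous_compact; [exact: continuous_subspaceT|exact: mfd_compact].
Qed.

Lemma bd_in_submanifold (M N : closedMfd) (W : bordism M N) :
  submanifold1 (@bd_in M N W).
Proof.
split; first exact: embedding_comp (@inL_embedding M N) (@bd_embedding _ _ W).
move=> x; right.
apply: (@flat_at_shrink _ _ _ _ (range (@bd_map M N W)) _ _
  (~` range (bd_out W))).
- apply: closed_openC; apply: closed_range; first exact: bd_hausdorff.
  exact: bd_out_continuous.
- by move=> [y _ /esym/bd_in_out].
- move=> w nw; split; first by move=> h; apply/range_bd_map; left.
  by move=> /range_bd_map[].
- exact: bd_flat.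
Qed.

Lemma bd_out_submanifold (M N : closedMfd) (W : bordism M N) :
  submanifold1 (@bd_out M N W).
Proof.
split; first exact: embedding_comp (@inR_embedding M N) (@bd_embedding _ _ W).
move=> x; right.
apply: (@flat_at_shrink _ _ _ _ (range (@bd_map M N W)) _ _
  (~` range (bd_in W))).
- apply: closed_openC; apply: closed_range; first exact: bd_hausdorff.
  exact: bd_in_continuous.
- by move=> [y _ /bd_in_out].
- move=> w nw; split; first by move=> h; apply/range_bd_map; right.
  by move=> /range_bd_map[].
- exact: bd_flat.
Qed.

Lemma bd_homeo_sub (M N : closedMfd) (W : bordism M N) (M' N' : closedMfd)
    (W' : bordism M' N') (phi : W -> W') : bd_homeo phi -> subbordism phi.
Proof.
move=> [hphi hin hout].
have phiin x : range (bd_in W') (phi (bd_in W x)).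
  by rewrite -hin; exists (bd_in W x) => //; exists x.
have phiout x : range (bd_out W') (phi (bd_out W x)).
  by rewrite -hout; exists (bd_out W x) => //; exists x.
split.
- exact: homeomorphism_embedding.
- move=> s; right.
  have -> : range (phi \o @bd_map M N W) = range (@bd_map M' N' W').
    apply/seteqP; split=> w.
      move=> [{}s _ <-]; apply/range_bd_map.
      elim/sumtP: s => x; first by left; exact: phiin.
      by right; exact: phiout.
    move=> /range_bd_map[]; rewrite -?hin -?hout => -[_ [x _ <-] <-].
      by exists (inL N x).
    by exists (inR M x).
  exact: bd_flat.
- by move=> x; right=> _ [_ [y _ <-] <-].
- by move=> x; right=> _ [_ [y _ <-] <-].
Qed.

Section SumSub.
Variables (M N M' N' : closedMfd) (W : bordism M N) (W' : bordism M' N').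

Lemma inL_sub : subbordism (inL W' : W -> bd_sum W W').
Proof.
split.
- apply: open_map_embedding; [exact: inL_inj|exact: inL_continuous|].
  exact: inL_open.
- move=> s; right.
  apply: (flat_at_transport (B := range (@bd_map _ _ W)) (@inL_inj _ _)
    (@inL_continuous _ _) (@inL_open _ _) _ (bd_flat _)) => w; split.
    by move=> [u _ /inL_inj <-]; exists u.
  by move=> [u _ <-]; exists u.
- by move=> x; right=> _ [_ [y _ <-] <-]; exists (inL M' y).
- by move=> x; right=> _ [_ [y _ <-] <-]; exists (inL N' y).
Qed.

Lemma inR_sub : subbordism (inR W : W' -> bd_sum W W').
Proof.
split.
- apply: open_map_embedding; [exact: inR_inj|exact: inR_continuous|].
  exact: inR_open.
- move=> s; right.
  apply: (flat_at_transport (B := range (@bd_map _ _ W')) (@inR_inj _ _)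
    (@inR_continuous _ _) (@inR_open _ _) _ (bd_flat _)) => w; split.
    by move=> [u _ /inR_inj <-]; exists u.
  by move=> [u _ <-]; exists u.
- by move=> x; right=> _ [_ [y _ <-] <-]; exists (inR M y).
- by move=> x; right=> _ [_ [y _ <-] <-]; exists (inR N y).
Qed.

End SumSub.

Definition isotopic_to_id (M : closedMfd) (phi : M -> M) : Prop :=
  exists H : M * itv01 -> M,
    [/\ continuous H, forall t, homeomorphism (fun x => H (x, t)),
        forall x, H (x, itv0) = x & forall x, H (x, itv1) = phi x].

(* Submanifolds being given by embeddings, restriction to a submanifold and
   pullback along a homeomorphism are instances of one operation, pullback along
   an embedding: [res] for bordisms, [mres] for closed n-manifolds, and [bres]
   for closed n-manifolds in bordisms. A homeomorphism [phi] of bordisms is a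
   surjective such embedding ([bd_homeo_sub]) and phi^* is its pullback.
   Functoriality thus comprises restriction in stages, the functoriality (hence
   bijectivity) of phi^*, and the compatibility of both. *)
Record fieldSystem := FieldSystem {
  fld : forall M N : closedMfd, bordism M N -> Type;
  mfld : closedMfd -> Type;
  res : forall (M0 N0 : closedMfd) (W0 : bordism M0 N0) (M N : closedMfd)
    (W : bordism M N) (e : W0 -> W), subbordism e -> fld W -> fld W0;
  mres : forall (M0 M : closedMfd) (e : M0 -> M),
    embedding e -> mfld M -> mfld M0;
  bres : forall (M0 M N : closedMfd) (W : bordism M N) (e : M0 -> W),
    submanifold1 e -> fld W -> mfld M0;
  res_id : forall (M N : closedMfd) (W : bordism M N)
    (h : subbordism (id : W -> W)) f, res h f = f;
  res_comp : forall (M1 N1 : closedMfd) (W1 : bordism M1 N1)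
    (M0 N0 : closedMfd) (W0 : bordism M0 N0)
    (M N : closedMfd) (W : bordism M N) (e1 : W1 -> W0) (e0 : W0 -> W)
    (h1 : subbordism e1) (h0 : subbordism e0) (h : subbordism (e0 \o e1)) f,
    res h f = res h1 (res h0 f);
  mres_id : forall (M : closedMfd) (h : embedding (id : M -> M)) f,
    mres h f = f;
  mres_comp : forall (M1 M0 M : closedMfd) (e1 : M1 -> M0) (e0 : M0 -> M)
    (h1 : embedding e1) (h0 : embedding e0) (h : embedding (e0 \o e1)) f,
    mres h f = mres h1 (mres h0 f);
  bres_res : forall (M1 M0 N0 : closedMfd) (W0 : bordism M0 N0)
    (M N : closedMfd) (W : bordism M N) (e1 : M1 -> W0) (e0 : W0 -> W)
    (h1 : submanifold1 e1) (h0 : subbordism e0) (h : submanifold1 (e0 \o e1))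
    f, bres h f = bres h1 (res h0 f);
  bres_mres : forall (M1 M0 M N : closedMfd) (W : bordism M N)
    (e1 : M1 -> M0) (e0 : M0 -> W) (h1 : embedding e1) (h0 : submanifold1 e0)
    (h : submanifold1 (e0 \o e1)) f, bres h f = mres h1 (bres h0 f);
  fld_empty : forall (M N : closedMfd) (W : bordism M N), (W -> False) ->
    exists p : fld W, forall q, q = p;
  mfld_empty : forall M : closedMfd, (M -> False) ->
    exists p : mfld M, forall q, q = p;
  fld_disj : forall (M N : closedMfd) (W : bordism M N)
    (M' N' : closedMfd) (W' : bordism M' N'),
    bijective (fun f : fld (bd_sum W W') =>
      (res (inL_sub W W') f, res (inR_sub W W') f));
  mfld_disj : forall M N : closedMfd,
    bijective (fun f : mfld (mfd_sum M N) =>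
      (mres (inL_embedding M N) f, mres (inR_embedding M N) f));
  fld_glue : forall (M N P : closedMfd) (W' : bordism M N)
    (W'' : bordism N P) (W : bordism M P) (i' : W' -> W) (i'' : W'' -> W)
    (g : gluing i' i'') (f' : fld W') (f'' : fld W''),
    bres (bd_out_submanifold W') f' = bres (bd_in_submanifold W'') f'' ->
    exists! f : fld W, res (gluing_sub' g) f = f' /\
                       res (gluing_sub'' g) f = f'' }.

End Manifolds.

Section Action.
Variables (R : realType) (n : nat) (C : strictMonCat) (F : fieldSystem R n).
Notation closedMfd := (closedMfd R n).

Record actionExp := ActionExp {
  act : forall (M N : closedMfd) (W : bordism M N), fld F W -> mor C;
  act_empty : forall (M N : closedMfd) (W : bordism M N) (p : fld F W),
    (W -> False) -> act p = idm (unit_ob C);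
  act_disj : forall (M N : closedMfd) (W : bordism M N)
    (M' N' : closedMfd) (W' : bordism M' N') (f : fld F (bd_sum W W')),
    act f = tens (act (res (inL_sub W W') f)) (act (res (inR_sub W W') f));
  act_glue : forall (M N P : closedMfd) (W' : bordism M N)
    (W'' : bordism N P) (W : bordism M P) (i' : W' -> W) (i'' : W'' -> W)
    (g : gluing i' i'') (f : fld F W),
    is_comp (act (res (gluing_sub'' g) f)) (act (res (gluing_sub' g) f))
      (act f);
  act_homeo : forall (M N : closedMfd) (W : bordism M N)
    (M' N' : closedMfd) (W' : bordism M' N') (phi : W -> W')
    (h : bd_homeo phi) (f : fld F W'),
    act (res (bd_homeo_sub h) f) = act f }.

Variable T : actionExp.

Definition cylindrically_firm : Prop :=
  forall (gamma : mor C) (M N : closedMfd)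
    (FM : fld F (cylinder M)) (FN : fld F (cylinder N)),
    CTC gamma (act T FM) (act T FN) = TCT gamma (act T FM) (act T FN).

Variable S : completeSemiRingType.
Notation Q := (Q C S).

(* Membership in the state module Z(M). *)
Definition state (M : closedMfd) (z : mfld F M -> Q) : Prop :=
  forall (phi : M -> M) (h : homeomorphism phi), isotopic_to_id phi ->
    forall f, z (mres (homeomorphism_embedding h) f) = z f.

Definition state_tens (M N : closedMfd) (z : mfld F M -> Q)
    (z' : mfld F N -> Q) : mfld F (mfd_sum M N) -> Q :=
  fun f => mulm (z (mres (inL_embedding M N) f))
                (z' (mres (inR_embedding M N) f)).

Lemma mfld_pair_ex (M N : closedMfd) (f : mfld F M) (g : mfld F N) :
  exists b : mfld F (mfd_sum M N),
    (mres (inL_embedding M N) b, mres (inR_embedding M N) b) = (f, g).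
Proof. by have [k _ kK] := mfld_disj F M N; exists (k (f, g)); exact: kK. Qed.

(* The inverse of the bijection [mfld_disj]. *)
Definition mfld_pair (M N : closedMfd) (f : mfld F M) (g : mfld F N) :
    mfld F (mfd_sum M N) := sval (cid (mfld_pair_ex f g)).

(* The state sum of [W], on fields on its boundary. *)
Definition state_sum (M N : closedMfd) (W : bordism M N) :
    mfld F (mfd_sum M N) -> Q := fun b =>
  sumQ (fun G : {G : fld F W | bres (bd_map_submanifold W) G = b} =>
    charQ S (act T (sval G))).

(* The two ends of the cylinder are [M] itself, so [f] and [h] are fields on
   [M]. *)
Definition proj (M : closedMfd) (z : mfld F M -> Q) : mfld F M -> Q := fun f =>
  sumQ (fun h : mfld F M =>
    mulc (state_sum (cylinder M) (mfld_pair f h)) (z h)).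

End Action.

Arguments proj {R n C F} T {S M} z _ _.
Arguments state_tens {R n C F S M N} z z' _ _.

(* Main.v *)
From mathcomp Require Import all_boot all_algebra all_classical all_reals.
From mathcomp Require Import topology.
Require Import Defs.

Set Implicit Arguments.
Unset Strict Implicit.
Unset Printing Implicit Defensive.

Import GRing.Theory.
Local Open Scope classical_set_scope.
Local Open Scope ring_scope.

(** Both sides of the identity, evaluated at a field [f] on M + N and a morphism
    gamma, are sums of the same terms over quadruples (G', G'', x, y): fields G'
    and G'' on the cylinders over M and N whose incoming restrictions are the two
    parts of [f], and morphisms x and y; the term is
    [zN (out G'') y * zM (out G') x].  Only the condition linking the quadruple
    to gamma differs.

    - On the left, the cylinder over M + N is homeomorphic, as a bordism, to the
      disjoint union of the cylinders over M and N, so a field on it is a pair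
      (G', G'') whose action is [tens (act G') (act G'')].  Convolving with the
      tensor product of the states asks for
      [comp (tens x y) (tens (act G') (act G'')) = gamma], which is membership of
      (x, y) in TCT ([proj_state_tensE]).
    - On the right, the two projections are formed separately and then
      multiplied, which asks for
      [tens (comp x (act G')) (comp y (act G'')) = gamma], which is membership of
      (x, y) in CTC ([tens_projE]).

    Cylindrical firmness is the equality of these two sets.

    In a noncommutative [S] the rearrangement needs care: the only factors ever
    moved past others are characteristic functions, whose values 0 and 1 are
    central, and the state values keep their order throughout.  All summation
    conditions are therefore carried as factors [ind P], which turns
    rearrangements into reindexing, exchange of sums over full types, and
    elimination of variables fixed by an equation. *)

(** * Sums in complete semirings *)

Section CompleteSums.
Variable S : completeSemiRingType.

Lemma eq_csum (I : Type) (a b : I -> S) : a =1 b -> csum a = csum b.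
Proof. by move=> /funext ->. Qed.

(** The fibres of a bijection are singletons, so the partition axiom applied to
    it is the change of variables. *)
Lemma reindex_csum (I J : Type) (f : I -> J) (m : J -> S) :
  bijective f -> csum (m \o f) = csum m.
Proof.
move=> [g fK gK]; rewrite -(csum_partition _ _ f); apply: eq_csum => j.
rewrite (csum_single _ (exist (fun i => f i = j) (g j) (gK j))) /= ?gK //.
by move=> [i fi]; apply: eq_exist; rewrite /= -fi fK.
Qed.

(** Fubini: the product is partitioned by its first projection, each fibre of
    which is a copy of the second factor. *)
Lemma csum_prod (I J : Type) (m : I * J -> S) :
  csum (fun i => csum (fun j => m (i, j))) = csum m.
Proof.
rewrite -(csum_partition _ _ fst); apply: eq_csum => i.
rewrite -(reindex_csum (f := fun j =>
  exist (fun p : I * J => p.1 = i) (i, j) (erefl i))) //.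
exists (fun p => (sval p).2) => //= -[[i' j] /= e].
by apply: eq_exist; rewrite /= -e.
Qed.

Lemma exchange_csum (I J : Type) (m : I -> J -> S) :
  csum (fun i => csum (m i)) = csum (fun j => csum (m^~ j)).
Proof.
rewrite (csum_prod (fun p => m p.1 p.2)) (csum_prod (fun p => m p.2 p.1)).
rewrite -[RHS](reindex_csum (f := fun p : I * J => (p.2, p.1))) //.
by exists (fun p => (p.2, p.1)) => -[].
Qed.

Lemma csum_mul (I J : Type) (a : I -> S) (b : J -> S) :
  csum a * csum b = csum (fun p => a p.1 * b p.2).
Proof.
rewrite -(csum_prod (fun p => a p.1 * b p.2)) -csum_distrr.
by apply: eq_csum => i; rewrite -csum_distrl.
Qed.

Definition ind (P : Prop) : S := if `[< P >] then 1 else 0.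

(** The values 0 and 1 of [ind] are central even when [S] is noncommutative. *)
Lemma ind_commute (P : Prop) (s t : S) : s * (ind P * t) = ind P * (s * t).
Proof. by rewrite /ind; case: asboolP; rewrite ?mul1r // !mul0r mulr0. Qed.

Lemma ind_and (P P' : Prop) (s : S) : ind P * (ind P' * s) = ind (P /\ P') * s.
Proof.
rewrite /ind; do 3!case: asboolP; rewrite ?mul1r ?mul0r ?mulr0 //.
- by move=> n p' p; case: n.
- by move=> [].
- by move=> [].
- by move=> [].
Qed.

Lemma eq_ind_mul (P P' : Prop) (s s' : S) :
  (P <-> P') -> (P -> s = s') -> ind P * s = ind P' * s'.
Proof.
move=> PP' ss'; rewrite (propext PP') /ind.
by case: asboolP => [/PP'/ss' -> //|_]; rewrite !mul0r.
Qed.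

(** The inclusion of a subtype partitions it into fibres which are singletons or
    empty; the empty ones contribute 0. *)
Lemma csum_sig (I : Type) (P : I -> Prop) (m : I -> S) :
  csum (fun i : {i | P i} => m (sval i)) = csum (fun i => ind (P i) * m i).
Proof.
rewrite -(csum_partition _ _ sval); apply: eq_csum => i.
rewrite /ind; case: asboolP => Pi; last first.
  rewrite mul0r csum_empty // => -[[j Pj] /= ji].
  by apply: Pi; rewrite -ji.
rewrite mul1r (csum_single _
  (exist (fun j : {i | P i} => sval j = i) (exist P i Pi) erefl)) //.
by move=> [[j Pj] /= ji]; do 2!apply: eq_exist => /=.
Qed.

Lemma csum_ind_eq (I : Type) (i0 : I) (m : I -> S) :
  csum (fun i => ind (i = i0) * m i) = m i0.
Proof.
rewrite -csum_sig (csum_single _ (exist (fun i => i = i0) i0 erefl)) //.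
by move=> [i ii0]; apply: eq_exist.
Qed.

End CompleteSums.
Arguments ind {S} P.

(** * Restriction of fields *)

Section Restrictions.
Variables (R : realType) (n : nat) (F : fieldSystem R n).

(** Restrictions in stages may be composed only along maps known to be
    submanifolds, so local flatness of the composites has to be supplied. *)
Lemma submanifold1_open_map (M : closedMfd R n) (X Y : topologicalType)
    (e : M -> X) (i : X -> Y) :
  submanifold1 e -> injective i -> continuous i -> open_map i ->
  submanifold1 (i \o e).
Proof.
move=> [emb_e flat_e] i_inj i_cont i_open; split.
  exact: embedding_comp emb_e (open_map_embedding i_inj i_cont i_open).
move=> x; case: (flat_e x) => h; [left|right];
  apply: (flat_at_transport i_inj i_cont i_open _ h) => y;
  (split; last by move=> [u _ <-]; exists u);
  by move=> [u _ /i_inj <-]; exists u.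
Qed.

Lemma eq_res (M0 N0 M N : closedMfd R n) (W0 : bordism M0 N0) (W : bordism M N)
    (e e' : W0 -> W) (h : subbordism e) (h' : subbordism e')
    (f : fld F W) :
  e =1 e' -> res h f = res h' f.
Proof.
move=> /funext ee'; subst e'; congr (res _ f); exact: Prop_irrelevance.
Qed.

Lemma eq_bres (M0 M N : closedMfd R n) (W : bordism M N)
    (e e' : M0 -> W) (h : submanifold1 e) (h' : submanifold1 e')
    (f : fld F W) :
  e =1 e' -> bres h f = bres h' f.
Proof.
move=> /funext ee'; subst e'; congr (bres _ f); exact: Prop_irrelevance.
Qed.

Lemma res_homeo_bij (M N M' N' : closedMfd R n) (W : bordism M N)
    (W' : bordism M' N') (phi : W -> W') (h : bd_homeo phi) :
  bijective (fun f : fld F W' => res (bd_homeo_sub h) f).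
Proof.
have [[cphi [psi [cpsi phiK psiK]]] phi_in phi_out] := h.
have h' : bd_homeo psi.
  split; first by split=> //; exists phi.
    rewrite -phi_in; apply/seteqP; split=> w /=.
      by move=> [_ [v v_in <-] <-]; rewrite phiK.
    by move=> w_in; exists (phi w); rewrite ?phiK //; exists w.
  rewrite -phi_out; apply/seteqP; split=> w /=.
    by move=> [_ [v v_out <-] <-]; rewrite phiK.
  by move=> w_out; exists (phi w); rewrite ?phiK //; exists w.
have sub_id (A B : closedMfd R n) (V : bordism A B) : subbordism (id : V -> V).
  apply: bd_homeo_sub; split; rewrite ?image_id //.
  by split; [move=> x; exact: cvg_id|exists id; split=> // x; exact: cvg_id].
exists (res (bd_homeo_sub h')) => f.
  have sub : subbordism (phi \o psi).
    by have -> : phi \o psi = id by exact/funext.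
  by rewrite -(res_comp _ _ sub) (eq_res _ (sub_id _ _ _) _ psiK) res_id.
have sub : subbordism (psi \o phi).
  by have -> : psi \o phi = id by exact/funext.
by rewrite -(res_comp _ _ sub) (eq_res _ (sub_id _ _ _) _ phiK) res_id.
Qed.

Lemma mfld_sum_eq (M N : closedMfd R n) (b b' : mfld F (mfd_sum M N)) :
  b = b' <-> mres (inL_embedding M N) b = mres (inL_embedding M N) b' /\
             mres (inR_embedding M N) b = mres (inR_embedding M N) b'.
Proof.
split=> [-> //|[eL eR]].
by apply: (bij_inj (mfld_disj F M N)); rewrite eL eR.
Qed.

(** Lets the boundary condition of a state sum be split into the incoming
    condition, which stays, and the outgoing one, which determines the field
    summed over in the projection. *)
Lemma bres_bd_map (M N : closedMfd R n) (W : bordism M N) (G : fld F W) f g :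
  bres (bd_map_submanifold W) G = mfld_pair f g <->
  bres (bd_in_submanifold W) G = f /\ bres (bd_out_submanifold W) G = g.
Proof.
rewrite mfld_sum_eq /mfld_pair; case: cid => b /= [-> ->].
by rewrite -(bres_mres _ _ (bd_in_submanifold W))
  -(bres_mres _ _ (bd_out_submanifold W)).
Qed.

End Restrictions.

(** * The cylinder over a disjoint union *)

Section CylinderSum.
Variables (R : realType) (n : nat) (M N : closedMfd R n).
Notation cylM := (cylinder M).
Notation cylN := (cylinder N).
Notation cyl2 := (bd_sum cylM cylN).
Notation cylMN := (cylinder (mfd_sum M N)).

Definition cyl_inL (p : cylM) : cylMN := (inL N p.1, p.2).
Definition cyl_inR (p : cylN) : cylMN := (inR M p.1, p.2).
Definition cyl_sum : cyl2 -> cylMN := copair cyl_inL cyl_inR.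

Lemma cyl_sum_continuous : continuous cyl_sum.
Proof.
apply: copair_continuous; apply: pair_continuous;
  try exact: snd_continuous.
  exact: continuous_compose (@fst_continuous _ _) (@inL_continuous M N).
exact: continuous_compose (@fst_continuous _ _) (@inR_continuous M N).
Qed.

Lemma cyl_sum_inj : injective cyl_sum.
Proof.
move=> p q; elim/sumtP: p => -[x s]; elim/sumtP: q => -[y t].
- by move=> /pair_equal_spec[/= /inL_inj -> ->].
- by move=> /pair_equal_spec[/= /inLR].
- by move=> /pair_equal_spec[/= /esym/inLR].
- by move=> /pair_equal_spec[/= /inR_inj -> ->].
Qed.

(** A continuous bijection from a compact space to a Hausdorff space. *)
Lemma cyl_sum_homeomorphism : homeomorphism cyl_sum.
Proof.
have [_ _ emb] : embedding cyl_sum.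
  apply: compact_embedding; [exact: bd_compact|exact: bd_hausdorff| |].
    exact: cyl_sum_continuous.
  exact: cyl_sum_inj.
have surj p : exists q, cyl_sum q = p.
  case: p => s t; elim/sumtP: s => x; first by exists (inL cylN (x, t)).
  by exists (inR cylM (x, t)).
pose g p := projT1 (cid (surj p)).
have gK : cancel g cyl_sum by move=> p; exact: projT2 (cid (surj p)).
split; first exact: cyl_sum_continuous.
exists g; split=> //; last by move=> p; apply: cyl_sum_inj; rewrite gK.
apply/continuousP => U /emb[V oV UV].
suff -> : g @^-1` U = V by [].
by rewrite UV; apply/seteqP; split=> p /=; rewrite gK.
Qed.

(** [cyl_sum] intertwines the boundary parametrizations pointwise, so the
    ranges of the incoming and outgoing ends correspond. *)
Lemma cyl_sum_bd_homeo : bd_homeo cyl_sum.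
Proof.
split; first exact: cyl_sum_homeomorphism.
  apply/seteqP; split=> p.
    by move=> [_ [s _ <-] <-]; exists s => //; elim/sumtP: s.
  move=> [s _ <-]; exists (bd_in cyl2 s); first by exists s.
  by elim/sumtP: s.
apply/seteqP; split=> p.
  by move=> [_ [s _ <-] <-]; exists s => //; elim/sumtP: s.
move=> [s _ <-]; exists (bd_out cyl2 s); first by exists s.
by elim/sumtP: s.
Qed.

Variable F : fieldSystem R n.

Definition fld_cyl_split (G : fld F cylMN) : fld F cylM * fld F cylN :=
  let G' := res (bd_homeo_sub cyl_sum_bd_homeo) G in
  (res (inL_sub cylM cylN) G', res (inR_sub cylM cylN) G').

Lemma fld_cyl_split_bij : bijective fld_cyl_split.
Proof.
exact: (bij_comp (fld_disj F cylM cylN) (res_homeo_bij F cyl_sum_bd_homeo)).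
Qed.

Lemma cyl_sum_open : open_map cyl_sum.
Proof.
have [_ [g [cg fK gK]]] := cyl_sum_homeomorphism.
move=> U oU; suff -> : cyl_sum @` U = g @^-1` U.
  by move/continuousP: cg; apply.
apply/seteqP; split=> p /=; first by move=> [q Uq <-]; rewrite fK.
by move=> Ugp; exists (g p).
Qed.

(** Splitting a field is compatible with restriction to the slices of the
    cylinder; it is used for the slices at 0 and at 1.  Both ways of restricting
    to M, through M + N and through the cylinder over M, are restriction along
    one map into the big cylinder. *)
Lemma fld_cyl_split_bres (eM : M -> cylM) (eN : N -> cylN)
    (e : mfd_sum M N -> cylMN) (hM : submanifold1 eM) (hN : submanifold1 eN)
    (h : submanifold1 e) (G : fld F cylMN) :
  (forall x, e (inL N x) = cyl_inL (eM x)) ->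
  (forall y, e (inR M y) = cyl_inR (eN y)) ->
  mres (inL_embedding M N) (bres h G) = bres hM (fld_cyl_split G).1 /\
  mres (inR_embedding M N) (bres h G) = bres hN (fld_cyl_split G).2.
Proof.
move=> eL eR.
have cL : submanifold1 (inL cylN \o eM : M -> cyl2).
  exact: submanifold1_open_map hM (@inL_inj _ _) (@inL_continuous _ _)
    (@inL_open _ _).
have cR : submanifold1 (inR cylM \o eN : N -> cyl2).
  exact: submanifold1_open_map hN (@inR_inj _ _) (@inR_continuous _ _)
    (@inR_open _ _).
have sL := submanifold1_open_map cL cyl_sum_inj cyl_sum_continuous cyl_sum_open.
have sR := submanifold1_open_map cR cyl_sum_inj cyl_sum_continuous cyl_sum_open.
have eLE : e \o inL N = cyl_sum \o (inL cylN \o eM) by exact/funext.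
have eRE : e \o inR M = cyl_sum \o (inR cylM \o eN) by exact/funext.
have tL : submanifold1 (e \o inL N) by rewrite eLE.
have tR : submanifold1 (e \o inR M) by rewrite eRE.
split.
  rewrite -(bres_mres _ _ tL) (eq_bres tL sL) //=.
  by rewrite -(bres_res _ _ cL) -(bres_res _ _ sL).
rewrite -(bres_mres _ _ tR) (eq_bres tR sR) //=.
by rewrite -(bres_res _ _ cR) -(bres_res _ _ sR).
Qed.

End CylinderSum.

(** * The projection of a tensor product of states *)

Section Projection.
Variables (R : realType) (n : nat) (S : completeSemiRingType).
Variables (C : strictMonCat) (F : fieldSystem R n) (T : actionExp C F).

Lemma mulmE (a b : Q C S) gamma :
  mulm a b gamma =
  csum (fun p => ind (tens p.1 p.2 = gamma) * (b p.2 * a p.1)).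
Proof. exact: (csum_sig _ (fun p => b p.2 * a p.1)). Qed.

(** Each field G on the cylinder contributes once: its outgoing restriction
    selects the boundary field summed over, and its action selects the inner
    factor of the convolution product. *)
Lemma projE (M : closedMfd R n) (z : mfld F M -> Q C S) f gamma :
  proj T z f gamma =
  csum (fun u : fld F (cylinder M) * mor C =>
    ind (bres (bd_in_submanifold (cylinder M)) u.1 = f /\
         is_comp u.2 (act T u.1) gamma) *
    z (bres (bd_out_submanifold (cylinder M)) u.1) u.2).
Proof.
(* The summation over [h] and [a] is kept, with the two equations which will
   eliminate it in front. *)
have term h : mulc (state_sum T S (cylinder M) (mfld_pair f h)) (z h) gamma =
    csum (fun p : (mor C * mor C) * fld F (cylinder M) =>
      ind (p.1.2 = act T p.2) *
      (ind (h = bres (bd_out_submanifold (cylinder M)) p.2) *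
       (ind (bres (bd_in_submanifold (cylinder M)) p.2 = f /\
             is_comp p.1.1 (act T p.2) gamma) * z h p.1.1))).
  rewrite -csum_prod.
  rewrite /mulc (csum_sig _ (fun p => z h p.1 * state_sum _ _ _ _ p.2)).
  apply: eq_csum => -[x a] /=.
  rewrite /state_sum /sumQ (csum_sig _ (fun G => charQ S (act T G) a)).
  rewrite -!csum_distrl; apply: eq_csum => G.
  (* A trailing factor 1 brings the last indicator into the shape [ind P * s]. *)
  rewrite -[charQ _ _ _]mulr1 -[charQ _ _ _]/(ind (a = act T G)).
  rewrite 2!(ind_commute _ (z h x)) mulr1 !ind_and.
  apply: eq_ind_mul => //; rewrite bres_bd_map.
  by split=> [[cmp [[Gin Gout] aG]]|[[aG Gout] [Gin cmp]]]; subst.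
rewrite /proj /sumQ; under eq_csum do rewrite term.
rewrite exchange_csum -csum_prod exchange_csum -csum_prod.
apply: eq_csum => G; rewrite -csum_prod; apply: eq_csum => x /=.
under eq_csum => a.
  under eq_csum do rewrite ind_commute.
  rewrite csum_ind_eq.
  over.
by rewrite csum_ind_eq.
Qed.

Variables (M N : closedMfd R n).
Variables (zM : mfld F M -> Q C S) (zN : mfld F N -> Q C S).
Notation cylM := (cylinder M).
Notation cylN := (cylinder N).
Notation inM := (bres (bd_in_submanifold cylM)).
Notation inN := (bres (bd_in_submanifold cylN)).
Notation outM := (bres (bd_out_submanifold cylM)).
Notation outN := (bres (bd_out_submanifold cylN)).

(** The common shape of both sides; [A] is [TCT] or [CTC]. *)
Definition cyl_pair_sum
    (A : mor C -> mor C -> mor C -> set (mor C * mor C))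
    (f : mfld F (mfd_sum M N)) : Q C S := fun gamma =>
  csum (fun u : (fld F cylM * fld F cylN) * (mor C * mor C) =>
    ind ((inM u.1.1 = mres (inL_embedding M N) f /\
          inN u.1.2 = mres (inR_embedding M N) f) /\
         A gamma (act T u.1.1) (act T u.1.2) u.2) *
    (zN (outN u.1.2) u.2.2 * zM (outM u.1.1) u.2.1)).

(** A field on the cylinder over M + N is a pair of fields, and summing over the
    outer factor [b] of the composite eliminates it by [b = tens x y]; what is
    left of the composability condition is TCT. *)
Lemma proj_state_tensE f gamma :
  proj T (state_tens zM zN) f gamma = cyl_pair_sum (@TCT C) f gamma.
Proof.
rewrite projE /cyl_pair_sum -[LHS]csum_prod -[RHS]csum_prod.
rewrite -(reindex_csum _ (fld_cyl_split_bij M N F)).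
apply: eq_csum => G /=.
under eq_csum => b.
  rewrite /state_tens mulmE -csum_distrl.
  under eq_csum do rewrite ind_commute.
  over.
rewrite exchange_csum; apply: eq_csum => -[x y] /=.
under eq_csum => b.
  have -> : (tens x y = b) = (b = tens x y) by apply/propext; split.
  over.
have [eoutM eoutN] := fld_cyl_split_bres (bd_out_submanifold cylM)
  (bd_out_submanifold cylN) (bd_out_submanifold (cylinder (mfd_sum M N)))
  G (fun=> erefl) (fun=> erefl).
have [einM einN] := fld_cyl_split_bres (bd_in_submanifold cylM)
  (bd_in_submanifold cylN) (bd_in_submanifold (cylinder (mfd_sum M N)))
  G (fun=> erefl) (fun=> erefl).
rewrite csum_ind_eq eoutM eoutN.
apply: eq_ind_mul => //; rewrite mfld_sum_eq einM einN.
by rewrite -(act_homeo T (cyl_sum_bd_homeo M N)) act_disj.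
Qed.

(** The product of the two projections is a double sum; the tensor factors [p]
    and [q] of [gamma] are determined as composites, and what is left of the
    conditions on them is CTC.  Both products are taken in the order N, then M,
    so no two state values are exchanged. *)
Lemma tens_projE f gamma :
  state_tens (proj T zM) (proj T zN) f gamma = cyl_pair_sum (@CTC C) f gamma.
Proof.
rewrite /state_tens mulmE.
pose sh (w : (fld F cylN * mor C) * (fld F cylM * mor C)) :=
  ((w.2.1, w.1.1), (w.2.2, w.1.2)).
have sh_bij : bijective sh.
  exists (fun u => ((u.1.2, u.2.2), (u.1.1, u.2.1))).
    by move=> [[? ?] [? ?]].
  by move=> [[? ?] [? ?]].
rewrite /cyl_pair_sum -(reindex_csum _ sh_bij).
under eq_csum => c.
  rewrite !projE csum_mul -csum_distrl.
  over.
rewrite exchange_csum; apply: eq_csum => -[[G'' y] [G' x]] /=.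
(* The pair of composites is the only one that can contribute to the sum over
   factorizations of [gamma]. *)
rewrite -(csum_ind_eq (comp x (act T G'), comp y (act T G''))
  (fun=> ind _ * _)).
apply: eq_csum => -[p q] /=.
rewrite -mulrA (ind_commute _ (zN _ _)) !ind_and; apply: eq_ind_mul => //.
split=> [[e [[eN [dN cN]] [eM [dM cM]]]]|].
  rewrite cN cM; do 2!split=> //.
  by exists p, q.
move=> [[-> ->] [[eM eN] [h' [h'' [[dM cM] [dN cN] e]]]]].
by rewrite cM cN.
Qed.

End Projection.

Theorem theorem9p4 (R : realType) (n : nat) (S : completeSemiRingType)
  (C : strictMonCat) (F : fieldSystem R n) (T : actionExp C F)
  (M N : closedMfd R n) (zM : mfld F M -> Q C S) (zN : mfld F N -> Q C S)
  (hM : state zM) (hN : state zN) (firm : cylindrically_firm T) :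
  proj T (state_tens zM zN) = state_tens (proj T zM) (proj T zN).
Proof.
apply/funext => f; apply/funext => gamma.
rewrite proj_state_tensE tens_projE; apply: eq_csum => u.
by rewrite firm.
Qed.
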